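(* Suppose $G$ is a simple graph with $n$ vertices and $k>1$ connected components. If $\Phi=\{\phi_i\}_{i\in[n]}$ is a $G(n,n-k)$-frame for $\mathbb{C}^{n-k}$, then the canonical dual frame of $\Phi$ is a non-unique spectrally optimal dual frame of $\Phi$ for $1$-erasure; that is, it is a spectrally optimal dual frame of $\Phi$ for $1$-erasure, and there is a dual frame of $\Phi$ different from the canonical dual frame which is also a spectrally optimal dual frame of $\Phi$ for $1$-erasure.
   Context: Write $[n]=\{1,\dots,n\}$; inner products on $\mathbb{C}^d$ are standard and linear in the first argument. A finite sequence $\Phi=\{\phi_i\}_{i\in[n]}$ in $\mathbb{C}^d$ is a frame for $\mathbb{C}^d$ if there are constants $0<A\le B$ with $A\|f\|^2\le\sum_{i\in[n]}|\langle f,\phi_i\rangle|^2\le B\|f\|^2$ for all $f\in\mathbb{C}^d$. Its frame operator is $S_\Phi f=\sum_{i\in[n]}\langle f,\phi_i\rangle\phi_i$ (invertible). A frame $\Psi=\{\psi_i\}_{i\in[n]}$ of $\mathbb{C}^d$ is a dual frame of $\Phi$ if $f=\sum_{i\in[n]}\langle f,\phi_i\rangle\psi_i=\sum_{i\in[n]}\langle f,\psi_i\rangle\phi_i$ for all $f\in\mathbb{C}^d$; $D_\Phi$ denotes the set of dual frames of $\Phi$. The canonical dual frame of $\Phi$ is $S_\Phi^{-1}\Phi:=\{S_\Phi^{-1}\phi_i\}_{i\in[n]}\in D_\Phi$. Spectral optimality: for $\Psi\in D_\Phi$ and $\Lambda\subset[n]$, the error operator is $E_{\Phi,\Psi,\Lambda}(f)=\sum_{i\in\Lambda}\langle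 f,\phi_i\rangle\psi_i$ on $\mathbb{C}^d$, and for $1\le r<n$, $\rho^{(r)}_{\Phi,\Psi}:=\max\{\rho(E_{\Phi,\Psi,\Lambda}):\Lambda\subset[n],\ |\Lambda|=r\}$, where $\rho(\cdot)$ is the spectral radius. Put $\rho^{(r)}_\Phi:=\min\{\rho^{(r)}_{\Phi,\widetilde\Psi}:\widetilde\Psi\in D_\Phi\}$. $\Psi\in D_\Phi$ is a spectrally optimal dual frame of $\Phi$ for $1$-erasure if $\rho^{(1)}_{\Phi,\Psi}=\rho^{(1)}_\Phi$. Graph frames: for a simple graph $G$ with vertices $v_1,\dots,v_n$, the Laplacian matrix is $L(G)=D(G)-A(G)$ (degree matrix minus adjacency matrix). A frame $\Phi=\{\phi_i\}_{i\in[n]}$ for $\mathbb{C}^m$ is a $G(n,m)$-frame (frame generated by $G$) if its Gramian matrix $\mathcal{G}_\Phi=[\langle\phi_j,\phi_i\rangle]_{i,j\in[n]}$ equals $L(G)$. *)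

(* Defs.v *)
From HB Require Import structures.
From mathcomp Require Import all_boot all_order all_algebra.
From mathcomp Require Import complex.
From mathcomp Require Import boolp classical_sets reals.

Set Implicit Arguments.
Unset Strict Implicit.
Unset Printing Implicit Defensive.

Import Order.TTheory GRing.Theory Num.Theory.
Local Open Scope classical_set_scope.
Local Open Scope complex_scope.
Local Open Scope ring_scope.

(* C^d is 'rV[R[i]]_d, for R : realType.  The inner product is the library's
   [dotmx f g = \sum_j f_j * (g_j)^* ], linear in its first argument.
   Operators on C^d are functions on row vectors; [lin1_mx T] is the matrix of
   T acting by right multiplication (v *m lin1_mx T = T v for linear T), and
   [eigenvalue], [invmx] are used through it. *)

Section Frames.
Variables (R : realType) (n d : nat).
Implicit Types (Phi Psi : 'I_n -> 'rV[R[i]]_d) (f : 'rV[R[i]]_d).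

(* The inequalities are in the order of R[i]; all terms are real. *)
Definition is_frame Phi : Prop :=
  exists A B : R, [/\ 0 < A, A <= B &
    forall f, A%:C * dotmx f f <= \sum_i `|dotmx f (Phi i)| ^+ 2
                               <= B%:C * dotmx f f].

Definition frame_op Phi f : 'rV[R[i]]_d :=
  \sum_i dotmx f (Phi i) *: Phi i.

Definition is_dual Phi Psi : Prop :=
  is_frame Psi /\
  forall f, f = \sum_i dotmx f (Phi i) *: Psi i /\
            f = \sum_i dotmx f (Psi i) *: Phi i.

Definition canonical_dual Phi : 'I_n -> 'rV[R[i]]_d :=
  fun i => Phi i *m invmx (lin1_mx (frame_op Phi)).

Definition error_op Phi Psi (L : {set 'I_n}) f : 'rV[R[i]]_d :=
  \sum_(i in L) dotmx f (Phi i) *: Psi i.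

(* On R[i] the norm `|a| is itself in R[i], hence the real part.  The set of
   eigenvalues is finite, and nonempty when 0 < d, so the sup is a maximum. *)
Definition spectral_radius (T : 'rV[R[i]]_d -> 'rV[R[i]]_d) : R :=
  sup [set complex.Re `|a| | a in [set a | eigenvalue (lin1_mx T) a]].

(* Spectral radii are nonnegative, so the default 0 of the iterated maximum
   has no effect when there is a set of cardinality r. *)
Definition rho_erasure (r : nat) Phi Psi : R :=
  \big[Num.max/0]_(L : {set 'I_n} | #|L| == r)
    spectral_radius (error_op Phi Psi L).

Definition is_min (X : set R) (m : R) : Prop := X m /\ lbound X m.

Definition spectrally_optimal (r : nat) Phi Psi : Prop :=
  is_dual Phi Psi /\
  is_min [set rho_erasure r Phi Psi' | Psi' in [set Psi' | is_dual Phi Psi']]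
         (rho_erasure r Phi Psi).

Definition gramian Phi : 'M[R[i]]_n :=
  \matrix_(i, j) dotmx (Phi j) (Phi i).

End Frames.

Section Graphs.
Variables (K : pzRingType) (n : nat) (e : rel 'I_n).

Definition simple_graph : Prop := symmetric e /\ irreflexive e.

Definition degree_mx : 'M[K]_n := diag_mx (\row_i #|[set j | e i j]%SET|%:R).

Definition adjacency_mx : 'M[K]_n := \matrix_(i, j) (e i j)%:R.

Definition laplacian_mx : 'M[K]_n := degree_mx - adjacency_mx.

End Graphs.

Definition graph_frame (R : realType) (n m : nat) (e : rel 'I_n)
    (Phi : 'I_n -> 'rV[R[i]]_m) : Prop :=
  is_frame Phi /\ gramian Phi = laplacian_mx R[i] e.

(* Main.v *)
(* Let Q_ij = <phi_j, psi_i> for a dual Psi of the graph frame Phi.  A relation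
   sum_i a_i phi_i = 0 amounts to L(G) a = 0, i.e. a has zero Dirichlet energy,
   i.e. a is constant on connected components; in particular the phi_i of a
   component C sum to 0.  By duality each column of Q - 1 gives such a relation,
   so Q - 1 is constant down C in every column, and the sum of Q_ii over C is
   |C| - 1 whatever Psi is.  For the canonical dual Q is hermitian, hence Q_ii
   is constant on C, equal to the average (|C| - 1)/|C|, which bounds
   max_i |Q_ii| = rho^(1) from below for every dual.  For non-uniqueness, add a
   nonzero phi_i to all dual vectors of a component not containing i: duality
   and the diagonal of Q are unchanged. *)
Require Import Defs.
From HB Require Import structures.
From mathcomp Require Import all_boot all_order all_algebra.
From mathcomp Require Import complex.
From mathcomp Require Import ring.
From mathcomp Require Import boolp classical_sets reals.

Set Implicit Arguments.
Unset Strict Implicit.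
Unset Printing Implicit Defensive.

Import Order.TTheory GRing.Theory Num.Theory.
Local Open Scope complex_scope.
Local Open Scope ring_scope.

(** * The hermitian product on row vectors and Cauchy-Schwarz *)

Section InnerProduct.
Variables (C : numClosedFieldType) (d : nat).
Implicit Types u v f : 'rV[C]_d.

Lemma dotmxC u v : dotmx u v = (dotmx v u)^*.
Proof. by rewrite (hermC (@dotmx C d)) expr0 mul1r. Qed.

Lemma dotmx_suml (I : finType) (P : pred I) (a : I -> C) (u : I -> 'rV[C]_d) v :
  dotmx (\sum_(i | P i) a i *: u i) v = \sum_(i | P i) a i * dotmx (u i) v.
Proof.
rewrite (linear_sumlz (@dotmx C d)); apply: eq_bigr => i _.
exact: (linearZl_LR (@dotmx C d)).
Qed.

Lemma dotmx_sumr (I : finType) (P : pred I) (a : I -> C) (u : I -> 'rV[C]_d) v :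
  dotmx v (\sum_(i | P i) a i *: u i) = \sum_(i | P i) (a i)^* * dotmx v (u i).
Proof.
rewrite dotmxC dotmx_suml rmorph_sum; apply: eq_bigr => i _ /=.
by rewrite rmorphM /= -(dotmxC v).
Qed.

Lemma dot0mx v : dotmx 0 v = 0.
Proof. exact: (linear0l (@dotmx C d)). Qed.

Lemma dotmxBl u v f : dotmx (u - v) f = dotmx u f - dotmx v f.
Proof. exact: (linearBl (@dotmx C d)). Qed.

Lemma dotmxDl u v f : dotmx (u + v) f = dotmx u f + dotmx v f.
Proof. exact: (linearDl (@dotmx C d)). Qed.

Lemma dotmxZl a u v : dotmx (a *: u) v = a * dotmx u v.
Proof. exact: (linearZl_LR (@dotmx C d)). Qed.

Lemma dotmx_ge0 u : 0 <= dotmx u u.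
Proof. exact: (dnorm_ge0 (@dotmx C d)). Qed.

Lemma dotmx_eq0 u : (dotmx u u == 0) = (u == 0).
Proof. exact: (dnorm_eq0 (@dotmx C d)). Qed.

Lemma dotmx_eq u v : (forall f, dotmx u f = dotmx v f) -> u = v.
Proof.
move=> uv; apply/eqP; rewrite -subr_eq0 -dotmx_eq0.
by rewrite dotmxBl uv subrr.
Qed.

Lemma dotmx_CauchySchwarz u v :
  `|dotmx u v| ^+ 2 <= dotmx u u * dotmx v v.
Proof. exact: (CauchySchwarz (@dotmx C d) u v).1. Qed.

End InnerProduct.

Lemma sum_CauchySchwarz (C : numClosedFieldType) (n : nat) (a b : 'I_n -> C) :
  `|\sum_i a i * (b i)^*| ^+ 2 <= (\sum_i `|a i| ^+ 2) * \sum_i `|b i| ^+ 2.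
Proof.
have dotE (x y : 'I_n -> C) :
    dotmx (\row_i x i) (\row_i y i) = \sum_i x i * (y i)^*.
  by rewrite dotmxE !mxE; apply: eq_bigr => i _; rewrite !mxE.
have := dotmx_CauchySchwarz (\row_i a i) (\row_i b i).
rewrite !dotE; congr (_ <= _ * _);
  by apply: eq_bigr => i _; rewrite normCK.
Qed.

(** * Trace and diagonal of a coefficient matrix over one block of indices *)

Section AbstractCoefficients.
Variables (C : numClosedFieldType) (I : finType).

(** Meant for [x] the diagonal of Q and [y] its row [i]; the $-1$ comes from the single index
    [j = i]. *)
Lemma sum_shifted_diag (P : {pred I}) i (x y : I -> C) : i \in P ->
  \sum_(j in P) y j = 0 ->
  (forall j, j \in P -> x j - 1 = y j - (i == j)%:R) ->
  \sum_(j in P) x j = #|P|%:R - 1.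
Proof.
move=> Pi y0 xy.
have : \sum_(j in P) (x j - 1) = \sum_(j in P) (y j - (i == j)%:R).
  exact: eq_bigr.
rewrite !sumrB y0 sumr_const sub0r.
have -> : \sum_(j in P) (i == j)%:R = 1 :> C.
  rewrite (bigD1 i) //= eqxx big1 ?addr0 // => j /andP[_ /negPf].
  by rewrite eq_sym => ->.
by move/eqP; rewrite subr_eq addrC => /eqP.
Qed.

(** Both diagonal entries, less 1, equal [y i j - (i == j)%:R]: one by column [j], the other by
    conjugating column [i]. *)
Lemma hermitian_diag_eq (y : I -> I -> C) i j :
  (forall k l, y k l = (y l k)^*) ->
  (forall l, y i l - (i == l)%:R = y j l - (j == l)%:R) ->
  y j j = y i i.
Proof.
move=> herm eqy; apply: (addIr (- 1)).
have := eqy j; rewrite eqxx => <-.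
have := eqy i; rewrite eqxx => /(congr1 Num.conj).
by rewrite !rmorphB /= conjC1 conjC_nat -!herm (eq_sym j) => ->.
Qed.

Lemma norm_mean_le (P : {pred I}) i (x r : C) (y : I -> C) : i \in P ->
  x *+ #|P| = \sum_(j in P) y j -> (forall j, `|y j| <= r) -> `|x| <= r.
Proof.
move=> Pi /(congr1 Num.norm) sumE y_le.
have P_gt0 : (0 < #|P|)%N by apply/card_gt0P; exists i.
rewrite -(ler_pMn2r P_gt0) -normrMn sumE -sumr_const.
by apply: le_trans (ler_norm_sum _ _ _) _; exact: ler_sum.
Qed.

End AbstractCoefficients.

Lemma ltr0c (R : rcfType) (x : R) : (0 < x%:C) = (0 < x).
Proof. exact: (ltcR 0 x). Qed.

(** * Dual frames, the canonical dual and one-erasure spectral radii *)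

Section DualFrames.
Variables (R : realType) (n d : nat).
Implicit Types (Phi Psi : 'I_n -> 'rV[R[i]]_d) (f : 'rV[R[i]]_d).

Lemma bessel_bound Phi : exists2 B : R, 0 <= B &
  forall f, \sum_i `|dotmx f (Phi i)| ^+ 2 <= B%:C * dotmx f f.
Proof.
pose B : R[i] := \sum_i dotmx (Phi i) (Phi i).
have B_ge0 : 0 <= B by apply: sumr_ge0 => i _; exact: dotmx_ge0.
have BE : B = (complex.Re B)%:C by rewrite RRe_real // ger0_real.
exists (complex.Re B); first by rewrite -ler0c -BE.
move=> f; rewrite -BE mulr_suml; apply: ler_sum => i _.
by rewrite mulrC; exact: dotmx_CauchySchwarz.
Qed.

(** Pairing the expansion of [f] with [f] and applying Cauchy-Schwarz bounds $\|f\|^4$ by the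
    product of the two coefficient energies; the Bessel bound of [Psi] then yields a lower frame
    bound for [Phi]. *)
Lemma reconstruction_frame Phi Psi :
  (forall f, f = \sum_i dotmx f (Phi i) *: Psi i) -> is_frame Phi.
Proof.
move=> rec; have [B B_ge0 leB] := bessel_bound Phi.
have [D D_ge0 leD] := bessel_bound Psi.
(* [D] may vanish, so [D + 1] is the constant to invert. *)
have D1_gt0 : 0 < D + 1 by rewrite ltr_wpDl.
exists (D + 1)^-1, (Num.max (D + 1)^-1 B).
split; rewrite ?invr_gt0 ?le_max ?lexx // => f.
have ff_ge0 : 0 <= dotmx f f := dotmx_ge0 f.
apply/andP; split; last first.
  apply: le_trans (leB f) _; apply: ler_wpM2r => //.
  by rewrite lecR le_max lexx orbT.
have D1C_gt0 : 0 < (D + 1)%:C by rewrite ltr0c.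
rewrite rmorphV ?unitfE ?gt_eqF // (ler_pdivrMl _ _ D1C_gt0).
have [f0|f_neq0] := eqVneq f 0.
  rewrite {1}f0 dot0mx; apply: mulr_ge0.
    by rewrite ler0c ltW.
  by apply: sumr_ge0 => i _; rewrite exprn_ge0.
have ff_gt0 : 0 < dotmx f f.
  by rewrite lt_neqAle eq_sym dotmx_eq0 f_neq0 dotmx_ge0.
rewrite -(ler_pM2r ff_gt0).
have -> : dotmx f f * dotmx f f =
    `|\sum_i dotmx f (Phi i) * (dotmx f (Psi i))^*| ^+ 2.
  rewrite -expr2 -[in LHS](ger0_norm ff_ge0) {1}(rec f) dotmx_suml.
  by under eq_bigr => i _ do rewrite (dotmxC (Psi i)).
apply: le_trans (sum_CauchySchwarz _ _) _.
rewrite mulrAC mulrC; apply: ler_wpM2r.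
  by apply: sumr_ge0 => i _; rewrite exprn_ge0.
apply: le_trans (leD f) _; apply: ler_wpM2r => //.
by rewrite lecR lerDl.
Qed.

(** The two reconstruction operators are adjoint to each other, and the identity is self-adjoint. *)
Lemma reconstruction_adjoint Phi Psi :
  (forall f, f = \sum_i dotmx f (Phi i) *: Psi i) ->
  forall f, f = \sum_i dotmx f (Psi i) *: Phi i.
Proof.
move=> rec f; apply: dotmx_eq => h.
rewrite [in LHS](rec h) dotmx_sumr dotmx_suml; apply: eq_bigr => i _.
by rewrite -(dotmxC (Phi i) h) mulrC.
Qed.

Lemma reconstruction_dual Phi Psi :
  (forall f, f = \sum_i dotmx f (Phi i) *: Psi i) -> is_dual Phi Psi.
Proof.
move=> rec; have rec' := reconstruction_adjoint rec.
by split=> [|f]; [exact: reconstruction_frame rec' | split].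
Qed.

Lemma frame_span Phi f :
  is_frame Phi -> (forall i, dotmx f (Phi i) = 0) -> f = 0.
Proof.
move=> [A [B [A_gt0 _ /(_ f)/andP[leA _]]]] f0.
apply/eqP; rewrite -dotmx_eq0 eq_le dotmx_ge0.
rewrite andbT -(pmulr_rle0 _ (_ : 0 < A%:C)) ?ltr0c //.
apply: le_trans leA _; rewrite big1 // => i _.
by rewrite f0 normr0 expr0n.
Qed.

Lemma mul_lin1_frame_op Phi f : f *m lin1_mx (frame_op Phi) = frame_op Phi f.
Proof.
apply/rowP => j; rewrite mxE.
under eq_bigr => k _ do rewrite mxE /frame_op summxE mulr_sumr.
rewrite exchange_big /= summxE; apply: eq_bigr => i _.
under eq_bigr => k _ do rewrite mxE mulrA.
rewrite -mulr_suml mxE; congr (_ * _).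
rewrite [in RHS]dotmxE mxE; apply: eq_bigr => k _; congr (_ * _).
rewrite dotmxE mxE (bigD1 k) //= big1 ?addr0; first by rewrite !mxE !eqxx mul1r.
by move=> l /negPf lk; rewrite !mxE lk mul0r.
Qed.

(** Since $\langle Sf,f\rangle=\sum_i|\langle f,\phi_i\rangle|^2$, the kernel of $S$ is orthogonal
    to every $\phi_i$. *)
Lemma frame_op_unit Phi : is_frame Phi -> lin1_mx (frame_op Phi) \in unitmx.
Proof.
move=> frP; rewrite -row_free_unit; apply/inj_row_free => f.
rewrite mul_lin1_frame_op => Sf0; apply: (frame_span frP) => i.
have : dotmx (frame_op Phi f) f = 0 by rewrite Sf0 dot0mx.
rewrite dotmx_suml; under eq_bigr => k _ do rewrite (dotmxC (Phi k)) -normCK.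
move=> /psumr_eq0P sum0; apply/eqP; rewrite -normr_eq0 -sqrf_eq0.
by apply/eqP/sum0 => // j _; rewrite exprn_ge0.
Qed.

Lemma frame_op_canonical_dual Phi i :
  is_frame Phi -> frame_op Phi (canonical_dual Phi i) = Phi i.
Proof. by move=> frP; rewrite -mul_lin1_frame_op mulmxKV ?frame_op_unit. Qed.

Lemma canonical_dual_is_dual Phi :
  is_frame Phi -> is_dual Phi (canonical_dual Phi).
Proof.
move=> frP; apply: reconstruction_dual => f.
rewrite -[LHS](mulmxK (frame_op_unit frP)) mul_lin1_frame_op mulmx_suml.
by apply: eq_bigr => i _; rewrite scalemxAl.
Qed.

Lemma frame_op_adjoint Phi f g :
  dotmx (frame_op Phi f) g = dotmx f (frame_op Phi g).
Proof.
rewrite /frame_op dotmx_sumr dotmx_suml; apply: eq_bigr => i _.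
by rewrite -(dotmxC (Phi i) g) mulrC.
Qed.

(** Writing $\phi_j=S\psi_j$ for the canonical dual, this is the self-adjointness of $S$. *)
Lemma canonical_dual_hermitian Phi i j : is_frame Phi ->
  dotmx (Phi j) (canonical_dual Phi i) =
  (dotmx (Phi i) (canonical_dual Phi j))^*.
Proof.
move=> frP.
have := frame_op_adjoint Phi (canonical_dual Phi j) (canonical_dual Phi i).
by rewrite !(frame_op_canonical_dual _ frP) => ->; exact: dotmxC.
Qed.

Lemma lin1_error_op1 Phi Psi i :
  lin1_mx (error_op Phi Psi [set i]%SET) = (map_mx Num.conj (Phi i)^T) *m Psi i.
Proof.
apply/matrixP => k j; rewrite mxE /error_op big_set1 !mxE big_ord1 !mxE.
congr (_ * _); rewrite dotmxE mxE (bigD1 k) //= big1 ?addr0.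
  by rewrite !mxE !eqxx mul1r.
by move=> l /negPf lk; rewrite !mxE lk mul0r.
Qed.

(** The operator $f\mapsto\langle f,\phi_i\rangle\psi_i$ has rank at most one, so its only possible
    eigenvalues are 0 and $\langle\psi_i,\phi_i\rangle$. *)
Lemma spectral_radius_error_op1 Phi Psi i :
  spectral_radius (error_op Phi Psi [set i]%SET) =
  complex.Re `|dotmx (Psi i) (Phi i)|.
Proof.
rewrite /spectral_radius lin1_error_op1.
set M := _ *m _; set x := dotmx _ _.
have mulM v : v *m M = dotmx v (Phi i) *: Psi i.
  by rewrite mulmxA [v *m _]mx11_scalar mul_scalar_mx -dotmxE.
have eigM a : eigenvalue M a -> a = 0 \/ a = x.
  move=> /eigenvalueP[v]; rewrite mulM => Mv v0.
  have [->|a0] := eqVneq a 0; [by left | right].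
  have c0 : dotmx v (Phi i) != 0.
    apply: contra_neq v0 => c0; apply/eqP; move/eqP: Mv.
    by rewrite c0 scale0r eq_sym scaler_eq0 (negPf a0).
  apply: (mulfI c0); rewrite mulrC.
  by rewrite -!dotmxZl -Mv.
set S := (X in sup X).
(* If [x] is not an eigenvalue, then [x = 0], as otherwise [Psi i] would be an eigenvector; so there
   is no eigenvalue at all, and the [sup] of the empty set is 0 by default. *)
have [xM|xNM] := boolP (eigenvalue M x); last first.
  have x0 : x = 0.
    apply/eqP; apply: contraNT xNM => x0; apply/eigenvalueP.
    exists (Psi i); first by rewrite mulM.
    by apply: contra_neq x0 => Psi0; rewrite /x Psi0 dot0mx.
  rewrite x0 normr0 sup_out // => -[[_ [a Ma _]] _].
  by move: xNM; rewrite x0; case: (eigM a Ma); rewrite ?x0 => <-; rewrite Ma.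
have Sx : S (complex.Re `|x|) by exists x.
have ub_x : ubound S (complex.Re `|x|).
  move=> _ [a /eigM[]-> <-] //.
  by rewrite normr0 -ler0c RRe_real ?normr_ge0 // ger0_real.
apply: le_anti; apply/andP; split.
  by apply: ge_sup => //; exists (complex.Re `|x|).
by apply: ub_le_sup => //; exists (complex.Re `|x|).
Qed.

Lemma rho_erasure1 Phi Psi :
  rho_erasure 1 Phi Psi =
  \big[Num.max/0]_i complex.Re `|dotmx (Psi i) (Phi i)|.
Proof.
apply: le_anti; apply/andP; split.
  apply/bigmax_leP; split; first exact: bigmax_ge_id.
  move=> L /cards1P[i ->]; rewrite spectral_radius_error_op1.
  exact: (le_bigmax_cond 0 (fun j => complex.Re `|dotmx (Psi j) (Phi j)|)).
apply/bigmax_leP; split; first exact: bigmax_ge_id.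
move=> i _; rewrite -spectral_radius_error_op1.
apply: (le_bigmax_cond 0 (fun L => spectral_radius (error_op Phi Psi L))).
by rewrite cards1.
Qed.

End DualFrames.

(** * Frames generated by a graph and their duals *)

Section GraphFrames.
Variables (R : realType) (n d : nat) (e : rel 'I_n).
Variable Phi : 'I_n -> 'rV[R[i]]_d.
Hypothesis e_sym : symmetric e.
Hypothesis PhiG : graph_frame e Phi.

Let frP : is_frame Phi := PhiG.1.

Lemma dotmx_graph_frame i j :
  dotmx (Phi j) (Phi i) = (\sum_l (e i l)%:R) *+ (i == j) - (e i j)%:R.
Proof.
have /matrixP/(_ i j) := PhiG.2; rewrite !mxE => ->; congr (_ *+ _ - _).
rewrite -sum1_card natr_sum big_mkcond; apply: eq_bigr => l _.
by rewrite inE; case: (e i l).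
Qed.

(** The right-hand side is entry [i] of $L(G)a$. *)
Lemma dotmx_synthesis (a : 'I_n -> R[i]) i :
  dotmx (\sum_j a j *: Phi j) (Phi i) = \sum_j (e i j)%:R * (a i - a j).
Proof.
pose deg : R[i] := \sum_l (e i l)%:R.
have GE j : dotmx (Phi j) (Phi i) = deg *+ (i == j) - (e i j)%:R.
  exact: dotmx_graph_frame.
rewrite dotmx_suml; under eq_bigr => j _ do rewrite GE mulrBr.
rewrite sumrB [X in X - _](bigD1 i) //= eqxx big1 ?addr0 => [|j /negPf ji].
  rewrite mulr1n mulr_sumr -sumrB; apply: eq_bigr => j _.
  by rewrite mulrBr ![_ * (e _ _)%:R]mulrC.
by rewrite eq_sym ji mulr0.
Qed.

Lemma synthesis0_connect (a : 'I_n -> R[i]) i j :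
  \sum_j a j *: Phi j = 0 -> connect e i j -> a i = a j.
Proof.
move=> s0.
have sum0 l : \sum_j (e l j)%:R * (a l - a j) = 0.
  by rewrite -dotmx_synthesis s0 dot0mx.
have energy0 : \sum_i \sum_j (e i j)%:R * `|a i - a j| ^+ 2 = 0.
  (* Splits $|a_i-a_j|^2=\bar a_i(a_i-a_j)+\bar a_j(a_j-a_i)$; symmetry of [e] makes both halves
     pairings with $L(G)a=0$. *)
  transitivity (\sum_i (a i)^* * (\sum_j (e i j)%:R * (a i - a j)) +
                \sum_j (a j)^* * (\sum_i (e j i)%:R * (a j - a i))).
    under [X in _ = X + _]eq_bigr => k _ do rewrite mulr_sumr.
    under [X in _ = _ + X]eq_bigr => k _ do rewrite mulr_sumr.
    rewrite [X in _ = _ + X]exchange_big /= -big_split /=.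
    apply: eq_bigr => k _; rewrite -big_split /=; apply: eq_bigr => l _.
    by rewrite normCK rmorphB (e_sym l k) /=; ring.
  by rewrite !big1 ?addr0 // => l _; rewrite sum0 mulr0.
have edge k l : e k l -> a k = a l.
  move=> ekl; apply/eqP; rewrite -subr_eq0 -normr_eq0 -sqrf_eq0.
  have term_ge0 k' l' : 0 <= (e k' l')%:R * `|a k' - a l'| ^+ 2.
    by rewrite mulr_ge0 ?ler0n ?exprn_ge0.
  have /psumr_eq0P/(_ k isT) row0 := energy0.
  have row_ge0 k' : true -> 0 <= \sum_l' (e k' l')%:R * `|a k' - a l'| ^+ 2.
    by move=> _; apply: sumr_ge0.
  have /psumr_eq0P/(_ l isT) := row0 row_ge0.
  by rewrite ekl mul1r => ->.
move=> /connectP[p ep ->]; elim: p i ep => //= l p IH k /andP[/edge-> /IH].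
by [].
Qed.

(** The indicator of a component does not change along an edge, so the sum is orthogonal to the
    whole frame. *)
Lemma sum_component_indicator i : \sum_j (connect e i j)%:R *: Phi j = 0.
Proof.
apply: (frame_span frP) => l; rewrite dotmx_synthesis big1 // => j _.
have [elj|_] := boolP (e l j); last by rewrite mul0r.
by rewrite (same_connect1r (sym_connect_sym e_sym) elj) subrr mulr0.
Qed.

Lemma sum_component i : \sum_(j in connect e i) Phi j = 0.
Proof.
rewrite -[RHS](sum_component_indicator i) big_mkcond; apply: eq_bigr => j _.
rewrite -[j \in _]/(connect e i j).
by case: (connect e i j); rewrite ?scale1r ?scale0r.
Qed.

Section Dual.
Variable Psi : 'I_n -> 'rV[R[i]]_d.
Hypothesis Psi_dual : is_dual Phi Psi.

Lemma dual_coef_connect i j l : connect e i j ->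
  dotmx (Phi l) (Psi i) - (i == l)%:R = dotmx (Phi l) (Psi j) - (j == l)%:R.
Proof.
apply: (@synthesis0_connect (fun j => dotmx (Phi l) (Psi j) - (j == l)%:R)).
under eq_bigr do rewrite scalerBl.
(* The relation is the expansion of [Phi l] through the dual, minus [Phi l] itself. *)
rewrite sumrB -(Psi_dual.2 (Phi l)).2 (bigD1 l) //= eqxx scale1r.
rewrite big1 ?addr0 ?subrr // => k /negPf->; exact: scale0r.
Qed.

Lemma dual_trace_component i :
  \sum_(j in connect e i) dotmx (Phi j) (Psi j) = #|connect e i|%:R - 1.
Proof.
apply: (@sum_shifted_diag _ _ _ i _ (fun j => dotmx (Phi j) (Psi i))).
- exact: connect0.
- under eq_bigr => j _ do rewrite -[Phi j]scale1r dotmxZl.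
  rewrite -dotmx_suml; under eq_bigr => j _ do rewrite scale1r.
  by rewrite sum_component dot0mx.
- by move=> j ij; have := dual_coef_connect j ij; rewrite eqxx => /esym.
Qed.

End Dual.

Let Can := canonical_dual Phi.
Let Can_dual : is_dual Phi Can := canonical_dual_is_dual frP.

Lemma canonical_dual_diag_component i j : connect e i j ->
  dotmx (Phi j) (Can j) = dotmx (Phi i) (Can i).
Proof.
move=> eij; apply: (@hermitian_diag_eq _ _ (fun k l => dotmx (Phi l) (Can k))).
  by move=> k l; exact: canonical_dual_hermitian.
by move=> l; exact: dual_coef_connect.
Qed.

Lemma rho_canonical_dual_min Psi : is_dual Phi Psi ->
  rho_erasure 1 Phi Can <= rho_erasure 1 Phi Psi.
Proof.
move=> Psi_dual; rewrite [leLHS]rho_erasure1.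
apply/bigmax_leP; split=> [|i _]; first by rewrite rho_erasure1 bigmax_ge_id.
have rhoP j : `|dotmx (Phi j) (Psi j)| <= (rho_erasure 1 Phi Psi)%:C.
  rewrite -[leLHS]RRe_real ?ger0_real // lecR rho_erasure1 dotmxC norm_conjC.
  exact: (le_bigmax_cond 0 (fun k => complex.Re `|dotmx (Psi k) (Phi k)|)).
rewrite -lecR RRe_real ?ger0_real // dotmxC norm_conjC.
(* The canonical entry is the mean over the component of the diagonal entries for [Psi], since both
   duals have the same trace there. *)
apply: (@norm_mean_le _ _ (connect e i) i _ _
          (fun j => dotmx (Phi j) (Psi j))) => //; first exact: connect0.
rewrite (dual_trace_component Psi_dual) -(dual_trace_component Can_dual).
rewrite -sumr_const; apply: eq_bigr => j /canonical_dual_diag_component jE.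
exact: esym jE.
Qed.

Lemma canonical_dual_optimal : spectrally_optimal 1 Phi Can.
Proof.
split=> //; split; first by exists Can.
by move=> _ [Psi Psi_dual <-]; exact: rho_canonical_dual_min.
Qed.

Lemma optimal_dual_shift i j : ~~ connect e i j -> Phi i != 0 ->
  exists Psi, Psi <> Can /\ spectrally_optimal 1 Phi Psi.
Proof.
move=> nij Phi0.
pose Psi l := Can l + (connect e j l)%:R *: Phi i.
have Psi_dual : is_dual Phi Psi.
  apply: reconstruction_dual => f.
  under eq_bigr do rewrite scalerDr scalerA.
  rewrite big_split /= -(Can_dual.2 f).1 -scaler_suml.
  rewrite -[LHS]addr0; congr (_ + _).
  (* Up to conjugation this pairs [f] with the sum of [Phi] over the component of [j], which is
     0. *)
  suff -> : \sum_l dotmx f (Phi l) * (connect e j l)%:R = 0.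
    by rewrite scale0r.
  rewrite -[LHS]conjCK rmorph_sum.
  under eq_bigr => l _ do rewrite rmorphM /= -dotmxC conjC_nat mulrC.
  by rewrite -dotmx_suml sum_component_indicator dot0mx conjC0.
have diag l : dotmx (Psi l) (Phi l) = dotmx (Can l) (Phi l).
  rewrite dotmxDl dotmxZl -[RHS]addr0; congr (_ + _).
  have [jl|_] := boolP (connect e j l); last by rewrite mul0r.
  rewrite mul1r dotmx_graph_frame.
  (* Distinct non-adjacent vertices have orthogonal frame vectors, so the shift leaves the diagonal
     unchanged. *)
  have nli : ~~ connect e l i.
    apply: contra nij => li; rewrite (sym_connect_sym e_sym).
    exact: connect_trans jl li.
  have [li|_] := eqVneq l i; first by rewrite li connect0 in nli.
  rewrite (negPf (_ : ~~ e l i)) ?subrr //.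
  by apply: contra nli; exact: connect1.
exists Psi; split.
  move=> /(congr1 (fun F => F j)); rewrite /Psi connect0 scale1r => /eqP.
  by rewrite -subr_eq0 addrC addKr (negPf Phi0).
have rhoE : rho_erasure 1 Phi Psi = rho_erasure 1 Phi Can.
  by rewrite !rho_erasure1; apply: eq_bigr => l _; rewrite diag.
split; first exact: Psi_dual.
split; first exact: (ex_intro2 _ _ Psi Psi_dual erefl).
rewrite rhoE; exact: canonical_dual_optimal.2.2.
Qed.

End GraphFrames.

(* [0 < n - k]: the space C^(n-k) is nonzero, without which the spectral radius
   of an operator on it is meaningless. *)
Theorem corollary3p2 (R : realType) (n k : nat) (e : rel 'I_n)
  (hG : simple_graph e)
  (hk : (1 < k)%N)
  (hcomp : n_comp e 'I_n = k)
  (hd : (0 < n - k)%N)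
  (Phi : 'I_n -> 'rV[R[i]]_(n - k))
  (hPhi : graph_frame e Phi) :
  spectrally_optimal 1 Phi (canonical_dual Phi) /\
  exists Psi : 'I_n -> 'rV[R[i]]_(n - k),
    Psi <> canonical_dual Phi /\ spectrally_optimal 1 Phi Psi.
Proof.
have [e_sym _] := hG; have cs := sym_connect_sym e_sym.
split; first exact: canonical_dual_optimal e_sym hPhi.
have [i Phi_i] : exists i, Phi i != 0.
  apply/existsP; apply: contraT; rewrite negb_exists => /forallP Phi0.
  (* If all [Phi i] vanished, the all-ones vector, nonzero by [hd], would be orthogonal to the
     frame. *)
  suff /rowP/(_ (Ordinal hd)) : const_mx 1 = 0 :> 'rV[R[i]]_(n - k).
    by rewrite !mxE => /eqP; rewrite oner_eq0.
  apply: (frame_span hPhi.1) => j; rewrite (eqP (negbNE (Phi0 j))).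
  by rewrite dotmxC dot0mx conjC0.
have [j nij] : exists j, ~~ connect e i j.
  (* If every vertex were connected to [i], there would be at most one component. *)
  apply/existsP; apply: contraLR hk; rewrite negb_exists => /forallP con.
  rewrite -leqNgt -hcomp -(n_comp_connect cs i).
  rewrite /n_comp_mem; apply/subset_leq_card/fintype.subsetP => j.
  by rewrite !inE => /andP[-> _]; exact: negbNE (con j).
exact: (optimal_dual_shift e_sym hPhi nij Phi_i).
Qed.
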